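(* Let $(A,m,\Delta)$ be a Hopf algebra over $\mathbb{K}$, of antipode $S$. Define $\Phi\colon A\otimes A\longrightarrow A\otimes A$ by \[\Phi(a\otimes b)=(\mathrm{Id}_A\otimes m)\circ(\mathrm{Id}_A\otimes S\otimes\mathrm{Id}_A)\circ(\Delta\otimes\mathrm{Id})\circ\tau(a\otimes b)=\sum b^{(1)}\otimes S\bigl(b^{(2)}\bigr)a\] for any $a,b\in A$. Then $(A,\Phi)$ is an $\ell$EAS. It is non-degenerate (i.e. $\Phi$ is bijective), and $\bigl(A,\Phi^{-1}\bigr)=\ell\mathbf{EAS}(A,m,\Delta^{\mathrm{op}})$.
   Context: $\mathbb{K}$ is a commutative field, all vector spaces are over $\mathbb{K}$, $\tau(x\otimes y)=y\otimes x$, $\Delta(a)=\sum a^{(1)}\otimes a^{(2)}$ is Sweedler's notation, and $\Delta^{\mathrm{op}}=\tau\circ\Delta$. A linear extended associative semigroup ($\ell$EAS) is a pair $(A,\Phi)$ where $A$ is a vector space and $\Phi\colon A\otimes A\to A\otimes A$ is a linear map with \[(\mathrm{Id}\otimes\Phi)\circ(\Phi\otimes\mathrm{Id})\circ(\mathrm{Id}\otimes\Phi)=(\Phi\otimes\mathrm{Id})\circ(\mathrm{Id}\otimes\tau)\circ(\Phi\otimes\mathrm{Id}).\] For a bialgebra $(A,m,\delta)$, $\ell\mathbf{EAS}(A,m,\delta)$ denotes the pair $(A,\Psi)$ with $\Psi=(m\otimes\mathrm{Id})\circ(\mathrm{Id}\otimes\tau)\circ(\delta\otimes\mathrm{Id})$;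 thus for $\delta=\Delta^{\mathrm{op}}$, $\Psi(a\otimes b)=\sum a^{(2)}b\otimes a^{(1)}$. *)

(* Defs.v *)
From HB Require Import structures.
From mathcomp Require Import all_boot all_order all_algebra.
From mathcomp Require Import boolp.
From mathcomp.multinomials Require Import freeg.

Set Implicit Arguments.
Unset Strict Implicit.
Unset Printing Implicit Defensive.

Import GRing.Theory.
Local Open Scope ring_scope.
Local Open Scope quotient_scope.

Reserved Notation "U ⊗ V" (at level 40, left associativity).
Reserved Notation "u ⊗t v" (at level 40, left associativity).

(* The tensor product of two (possibly infinite-dimensional) vector spaces is
   the free vector space on U * V, divided by the subspace spanned by the
   bilinearity relations. *)
Section Tensor.
Variables (K : fieldType) (U V : lmodType K).

Local Notation F := {freeg (U * V) / K}.
Local Notation "[ u , v ]" := (<< (u, v) >> : F).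

Inductive tens_rel : F -> Prop :=
| TensRel0 : tens_rel 0
| TensRelP a x y : tens_rel x -> tens_rel y -> tens_rel (a *: x + y)
| TensRelL a u u' v : tens_rel ([a *: u + u', v] - (a *: [u, v] + [u', v]))
| TensRelR a u v v' : tens_rel ([u, a *: v + v'] - (a *: [u, v] + [u, v'])).

Definition tens_null : {pred F} := fun x => `[< tens_rel x >].

Lemma tens_nullP x : reflect (tens_rel x) (x \in tens_null).
Proof. exact: asboolP. Qed.

Lemma tens_null_zmod_closed : zmod_closed tens_null.
Proof.
split=> [|x y /tens_nullP hx /tens_nullP hy]; apply/tens_nullP.
  exact: TensRel0.
by rewrite addrC -scaleN1r; exact: TensRelP.
Qed.

HB.instance Definition _ := GRing.isZmodClosed.Build F tens_null
  tens_null_zmod_closed.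

Lemma tens_nullZ a x : x \in tens_null -> a *: x \in tens_null.
Proof.
move=> /tens_nullP hx; apply/tens_nullP; rewrite -[_ *: _]addr0.
by apply: TensRelP => //; exact: TensRel0.
Qed.

Definition tens : Type := {ideal_quot tens_null}.
HB.instance Definition _ := Choice.on tens.
HB.instance Definition _ := GRing.Zmodule.on tens.
HB.instance Definition _ := EqQuotient.on tens.

Definition tens_pi (x : F) : tens := \pi_{ideal_quot tens_null} x.
Definition tens_repr (x : tens) : F := repr (x : {ideal_quot tens_null}).

Lemma tens_reprK x : tens_pi (tens_repr x) = x.
Proof. exact: reprK. Qed.

Lemma tens_piB : zmod_morphism tens_pi.
Proof. move=> x y; exact: (raddfB \pi_{ideal_quot tens_null}). Qed.

HB.instance Definition _ := GRing.isZmodMorphism.Build F tens tens_pi tens_piB.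

Lemma tens_pi_eq x y : (tens_pi x == tens_pi y) = (x - y \in tens_null).
Proof. by rewrite Quotient.idealrBE. Qed.

Definition tens_scale (a : K) (x : tens) : tens := tens_pi (a *: tens_repr x).

Lemma tens_piZ a x : tens_scale a (tens_pi x) = tens_pi (a *: x).
Proof.
apply/eqP; rewrite tens_pi_eq -scalerBr tens_nullZ //.
by rewrite -tens_pi_eq tens_reprK.
Qed.

Lemma tens_scaleA a b x : tens_scale a (tens_scale b x) = tens_scale (a * b) x.
Proof. by rewrite -[x]tens_reprK !tens_piZ scalerA. Qed.
Lemma tens_scale1 : left_id 1 tens_scale.
Proof. by move=> x; rewrite -[x]tens_reprK !tens_piZ scale1r. Qed.
Lemma tens_scaleDr : right_distributive tens_scale +%R.
Proof.
move=> a x y; rewrite -[x]tens_reprK -[y]tens_reprK -raddfD !tens_piZ.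
by rewrite scalerDr raddfD.
Qed.
Lemma tens_scaleDl x : {morph tens_scale^~ x : a b / a + b}.
Proof.
by move=> a b; rewrite -[x]tens_reprK !tens_piZ scalerDl raddfD.
Qed.

HB.instance Definition _ := GRing.Zmodule_isLmodule.Build K tens
  tens_scaleA tens_scale1 tens_scaleDr tens_scaleDl.

Lemma tens_pi_scalable : scalable tens_pi.
Proof. by move=> a x; rewrite -tens_piZ. Qed.

HB.instance Definition _ := GRing.isScalable.Build K F tens *:%R tens_pi
  tens_pi_scalable.

Definition tensor (u : U) (v : V) : tens := tens_pi [u, v].

Lemma tensor_is_bilinear : bilinear_for
  (GRing.Scale.Law.clone _ _ *:%R _) (GRing.Scale.Law.clone _ _ *:%R _) tensor.
Proof.
split=> [v|u] a x y /=; rewrite /tensor -linearP; apply/eqP;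
  rewrite tens_pi_eq; apply/tens_nullP.
- exact: TensRelL.
- exact: TensRelR.
Qed.

HB.instance Definition _ := bilinear_isBilinear.Build K U V tens _ _ tensor
  tensor_is_bilinear.

Lemma tens_ind (P : tens -> Prop) :
  P 0 -> (forall x y, P x -> P y -> P (x + y)) ->
  (forall u v, P (tensor u v)) -> forall x, P x.
Proof.
move=> P0 PD Pt x; rewrite -[x]tens_reprK -[tens_repr x]freeg_sumE raddf_sum.
elim/big_rec: _ => //= -[u v] y _ Py; apply: PD => //.
set c := coeff _ _.
have -> : << c *g (u, v) >> = c *: [u, v] :> F.
  by apply/eqP/freeg_eqP => p; rewrite coeffZ !coeffU mul1r.
rewrite linearZ /= -/(tensor u v) -[_ *: _]/(c *: tensor u v).
by rewrite -linearZl_LR; exact: Pt.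
Qed.

End Tensor.

Notation "U ⊗ V" := (tens U V).
Notation "u ⊗t v" := (tensor u v) : ring_scope.

Section TensorLift.
Variables (K : fieldType) (U V W : lmodType K) (f : {bilinear U -> V -> W}).

Local Notation F := {freeg (U * V) / K}.
Let f' (p : U * V) : W := f p.1 p.2.

Fact fglift_is_linear : linear (fglift f' : F -> W).
Proof.
have fB := lift_is_additive f' : zmod_morphism (fglift f').
pose fA := GRing.isZmodMorphism.Build F W _ fB.
pose g : {additive F -> W} := HB.pack (fglift f') fA.
suff gZ a x : g (a *: x) = a *: g x.
  by move=> a x y; rewrite -[LHS]/(g _) raddfD gZ.
rewrite -[x]freeg_sumE scaler_sumr !(raddf_sum g) scaler_sumr.
apply: eq_bigr => p _; set c := coeff _ _.
have -> : a *: << c *g p >> = << (a * c) *g p >> :> F.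
  by apply/eqP/freeg_eqP => q; rewrite coeffZ !coeffU mulrA.
by rewrite /g /= !liftU scalerA.
Qed.

HB.instance Definition _ := GRing.isLinear.Build K F W _ (fglift f' : F -> W)
  fglift_is_linear.

Fact fglift_rel0 x : tens_rel x -> fglift f' x = 0.
Proof.
have lin := fglift_is_linear.
elim=> {x} [|a x y _ x0 _ y0|a u u' v|a u v v'].
- exact: raddf0.
- by rewrite lin x0 y0 scaler0 addr0.
- by rewrite (zmod_morphism_linear lin) lin !liftU !scale1r /f' /= linearPl subrr.
- by rewrite (zmod_morphism_linear lin) lin !liftU !scale1r /f' /= linearPr subrr.
Qed.

Definition tlift (x : U ⊗ V) : W := fglift f' (tens_repr x).

Fact tlift_pi x : tlift (tens_pi x) = fglift f' x.
Proof.
apply/eqP; rewrite -subr_eq0 -raddfB; apply/eqP/fglift_rel0/tens_nullP.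
by rewrite -tens_pi_eq tens_reprK.
Qed.

Fact tlift_is_linear : linear tlift.
Proof.
move=> a x y; rewrite -[x]tens_reprK -[y]tens_reprK -linearP !tlift_pi.
exact: fglift_is_linear.
Qed.

HB.instance Definition _ := GRing.isLinear.Build K (tens U V) W _ tlift
  tlift_is_linear.

Lemma tliftE u v : tlift (u ⊗t v) = f u v.
Proof. by rewrite tlift_pi liftU scale1r. Qed.

End TensorLift.

Lemma tens_linear_ext (K : fieldType) (U V W : lmodType K)
  (f g : {linear U ⊗ V -> W}) :
  (forall u v, f (u ⊗t v) = g (u ⊗t v)) -> f =1 g.
Proof.
move=> fg x; elim/tens_ind: x => [|x y fx fy|//]; first by rewrite !raddf0.
by rewrite !linearD fx fy.
Qed.

Section TensorMaps.
Variable K : fieldType.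
Implicit Types U V W X : lmodType K.

Section Functor.
Variables (U U' V V' : lmodType K).
Variables (f : {linear U -> U'}) (g : {linear V -> V'}).

Let tmap_fun (u : U) (v : V) : U' ⊗ V' := f u ⊗t g v.

Fact tmap_is_bilinear : bilinear_for
  (GRing.Scale.Law.clone _ _ *:%R _) (GRing.Scale.Law.clone _ _ *:%R _)
  tmap_fun.
Proof.
by split=> [v|u] a x y /=; rewrite /tmap_fun linearP ?linearPl ?linearPr.
Qed.

HB.instance Definition _ := bilinear_isBilinear.Build K U V (tens U' V') _ _
  tmap_fun tmap_is_bilinear.

Definition tmap : {linear U ⊗ V -> U' ⊗ V'} := tlift tmap_fun.

Lemma tmapE u v : tmap (u ⊗t v) = f u ⊗t g v. Proof. exact: tliftE. Qed.

End Functor.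

Section Flip.
Variables (U V : lmodType K).

Let tau_fun (u : U) (v : V) : V ⊗ U := v ⊗t u.

Fact tau_is_bilinear : bilinear_for
  (GRing.Scale.Law.clone _ _ *:%R _) (GRing.Scale.Law.clone _ _ *:%R _)
  tau_fun.
Proof. by split=> [v|u] a x y /=; rewrite /tau_fun ?linearPl ?linearPr. Qed.

HB.instance Definition _ := bilinear_isBilinear.Build K U V (tens V U) _ _
  tau_fun tau_is_bilinear.

Definition tau : {linear U ⊗ V -> V ⊗ U} := tlift tau_fun.

Lemma tauE u v : tau (u ⊗t v) = v ⊗t u. Proof. exact: tliftE. Qed.

End Flip.

Section Assoc.
Variables (U V W : lmodType K).

Let assoc_fun (x : U ⊗ V) (w : W) : U ⊗ (V ⊗ W) :=
  tmap idfun (applyr (@tensor K V W) w) x.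

Fact assoc_is_bilinear : bilinear_for
  (GRing.Scale.Law.clone _ _ *:%R _) (GRing.Scale.Law.clone _ _ *:%R _)
  assoc_fun.
Proof.
split=> [w|x] a y z /=; first by rewrite /assoc_fun linearP.
elim/tens_ind: x => [|x x' IHx IHx'|u v].
- by rewrite /assoc_fun !linear0 ?scaler0 addr0.
- rewrite /assoc_fun !linearD -!/(assoc_fun _ _) IHx IHx' /=.
  by rewrite addrACA.
- by rewrite /assoc_fun !tmapE /= !linearPr.
Qed.

HB.instance Definition _ := bilinear_isBilinear.Build K (tens U V) W
  (tens U (tens V W)) _ _ assoc_fun assoc_is_bilinear.

Definition assoc : {linear U ⊗ V ⊗ W -> U ⊗ (V ⊗ W)} := tlift assoc_fun.

Lemma assocE u v w : assoc (u ⊗t v ⊗t w) = u ⊗t (v ⊗t w).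
Proof. by rewrite /assoc /= tliftE /= /assoc_fun tmapE. Qed.

Let assocV_fun (u : U) (x : V ⊗ W) : U ⊗ V ⊗ W :=
  tmap ((@tensor K U V : {bilinear U -> V -> U ⊗ V}) u) idfun x.

Fact assocV_is_bilinear : bilinear_for
  (GRing.Scale.Law.clone _ _ *:%R _) (GRing.Scale.Law.clone _ _ *:%R _)
  assocV_fun.
Proof.
split=> [x|u] a y z /=; last by rewrite /assocV_fun linearP.
elim/tens_ind: x => [|x x' IHx IHx'|v w].
- by rewrite /assocV_fun !linear0 ?scaler0 addr0.
- rewrite /assocV_fun !linearD -!/(assocV_fun _ _) IHx IHx' /=.
  by rewrite addrACA.
- by rewrite /assocV_fun !tmapE /= !linearPl.
Qed.

HB.instance Definition _ := bilinear_isBilinear.Build K U (tens V W)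
  (tens (tens U V) W) _ _ assocV_fun assocV_is_bilinear.

Definition assocV : {linear U ⊗ (V ⊗ W) -> U ⊗ V ⊗ W} := tlift assocV_fun.

Lemma assocVE u v w : assocV (u ⊗t (v ⊗t w)) = u ⊗t v ⊗t w.
Proof. by rewrite /assocV /= tliftE /= /assocV_fun tmapE. Qed.

End Assoc.

(* The identifications K ⊗ V = V and V ⊗ K = V *)
Section Unit.
Variable V : lmodType K.

Let lunit_fun (k : K^o) (v : V) : V := k *: v.

Fact lunit_is_bilinear : bilinear_for
  (GRing.Scale.Law.clone _ _ *:%R _) (GRing.Scale.Law.clone _ _ *:%R _)
  lunit_fun.
Proof.
split=> [v|k] a x y /=; rewrite /lunit_fun; first by rewrite scalerDl scalerA.
by rewrite scalerDr !scalerA mulrC.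
Qed.

HB.instance Definition _ := bilinear_isBilinear.Build K K^o V V _ _
  lunit_fun lunit_is_bilinear.

Definition lunit : {linear K^o ⊗ V -> V} := tlift lunit_fun.
Definition runit : {linear V ⊗ K^o -> V} := lunit \o tau V K^o.

Lemma lunitE (k : K) v : lunit ((k : K^o) ⊗t v) = k *: v.
Proof. exact: tliftE. Qed.
Lemma runitE (k : K) v : runit (v ⊗t (k : K^o)) = k *: v.
Proof. by rewrite /runit /= tauE lunitE. Qed.

End Unit.

(* Triple tensor products are bracketed to the left, so Id ⊗ g has to be
   conjugated by the associativity isomorphism. *)
Definition actl U V U' V' W (f : {linear U ⊗ V -> U' ⊗ V'}) :
  {linear U ⊗ V ⊗ W -> U' ⊗ V' ⊗ W} := tmap f idfun.

Definition actr U V W V' W' (g : {linear V ⊗ W -> V' ⊗ W'}) :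
  {linear U ⊗ V ⊗ W -> U ⊗ V' ⊗ W'} :=
  assocV U V' W' \o tmap idfun g \o assoc U V W.

End TensorMaps.

Section MulMap.
Variables (K : fieldType) (A : algType K).

Let mul_fun (a b : A) : A := a * b.

Fact mul_is_bilinear : bilinear_for
  (GRing.Scale.Law.clone _ _ *:%R _) (GRing.Scale.Law.clone _ _ *:%R _)
  mul_fun.
Proof.
split=> [b|b] a x y /=; rewrite /mul_fun.
- by rewrite mulrDl scalerAl.
- by rewrite mulrDr scalerAr.
Qed.

HB.instance Definition _ := bilinear_isBilinear.Build K A A A _ _
  mul_fun mul_is_bilinear.

Definition mulmap : {linear A ⊗ A -> A} := tlift mul_fun.

Lemma mulmapE a b : mulmap (a ⊗t b) = a * b. Proof. exact: tliftE. Qed.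

End MulMap.

Section Hopf.
Variables (K : fieldType) (A : algType K).
Implicit Types (Delta : {linear A -> A ⊗ A}) (eps : {linear A -> K^o}).
Implicit Types (S : {linear A -> A}).

Record is_coalgebra Delta eps : Prop := IsCoalgebra {
  coassociative : assoc A A A \o tmap Delta idfun \o Delta
                  =1 tmap idfun Delta \o Delta;
  counit_l : lunit A \o tmap eps idfun \o Delta =1 idfun;
  counit_r : runit A \o tmap idfun eps \o Delta =1 idfun
}.

(* Id ⊗ tau ⊗ Id *)
Definition tau_mid : {linear (A ⊗ A) ⊗ (A ⊗ A) -> (A ⊗ A) ⊗ (A ⊗ A)} :=
  assoc (A ⊗ A) A A \o actl A (actr A (tau A A)) \o assocV (A ⊗ A) A A.

Lemma tau_midE a b c d :
  tau_mid ((a ⊗t b) ⊗t (c ⊗t d)) = (a ⊗t c) ⊗t (b ⊗t d).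
Proof.
by rewrite /= assocVE /actl tmapE /= assocE tmapE tauE assocVE assocE.
Qed.

(* A mathcomp [algType] is nontrivial; for a bialgebra this is no restriction,
   since the counit sends 1 to 1 <> 0. *)
Record is_bialgebra Delta eps : Prop := IsBialgebra {
  bialgebra_coalgebra : is_coalgebra Delta eps;
  comul1 : Delta 1 = 1 ⊗t 1;
  comulM : Delta \o mulmap A
           =1 tmap (mulmap A) (mulmap A) \o tau_mid \o tmap Delta Delta;
  counit1 : eps 1 = 1;
  counitM : {morph eps : a b / a * b}
}.

Record is_hopf Delta eps S : Prop := IsHopf {
  hopf_bialgebra : is_bialgebra Delta eps;
  antipode_l : mulmap A \o tmap S idfun \o Delta =1 (fun a => eps a *: 1);
  antipode_r : mulmap A \o tmap idfun S \o Delta =1 (fun a => eps a *: 1)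
}.

End Hopf.

Record tensor_endo (K : fieldType) := TensorEndo {
  te_space : lmodType K;
  te_map :> {linear te_space ⊗ te_space -> te_space ⊗ te_space}
}.

Definition is_lEAS (K : fieldType) (E : tensor_endo K) : Prop :=
  let Phi12 := actl (te_space E) E in
  let Phi23 := actr (te_space E) E in
  Phi23 \o Phi12 \o Phi23
  =1 Phi12 \o actr (te_space E) (tau (te_space E) (te_space E)) \o Phi12.

Definition lEAS_nondegenerate (K : fieldType) (E : tensor_endo K) : Prop :=
  bijective E.

(* (A, (m ⊗ Id) o (Id ⊗ tau) o (delta ⊗ Id)), m being the product of A *)
Definition lEAS_of (K : fieldType) (A : algType K)
    (delta : {linear A -> A ⊗ A}) : tensor_endo K :=
  TensorEndo (tmap (mulmap A) idfun \o actr A (tau A A) \o tmap delta idfun).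

Definition coop (K : fieldType) (A : lmodType K)
    (Delta : {linear A -> A ⊗ A}) : {linear A -> A ⊗ A} := tau A A \o Delta.

Definition hopf_map (K : fieldType) (A : algType K)
    (Delta : {linear A -> A ⊗ A}) (S : {linear A -> A}) :
    {linear A ⊗ A -> A ⊗ A} :=
  tmap idfun (mulmap A) \o assoc A A A \o tmap (tmap idfun S) idfun
  \o tmap Delta idfun \o tau A A.

Section Sweedler.
Variables (K : fieldType) (A : algType K) (Delta : {linear A -> A ⊗ A}).

Lemma hopf_mapE (S : {linear A -> A}) a b (I : Type) (r : seq I)
    (b1 b2 : I -> A) :
  Delta b = \sum_(i <- r) b1 i ⊗t b2 i ->
  hopf_map Delta S (a ⊗t b) = \sum_(i <- r) b1 i ⊗t (S (b2 i) * a).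
Proof.
move=> bE; rewrite /= tauE tmapE bE linear_sumlz !linear_sum.
by apply: eq_bigr => i _; rewrite !tmapE /= assocE tmapE mulmapE.
Qed.

Lemma lEAS_of_coopE a b (I : Type) (r : seq I) (a1 a2 : I -> A) :
  Delta a = \sum_(i <- r) a1 i ⊗t a2 i ->
  lEAS_of (coop Delta) (a ⊗t b) = \sum_(i <- r) (a2 i * b) ⊗t a1 i.
Proof.
move=> aE; rewrite /= tmapE /= aE linear_sum linear_sumlz !linear_sum.
apply: eq_bigr => i _.
by rewrite tauE /= assocE tmapE tauE assocVE tmapE mulmapE.
Qed.

End Sweedler.

(* Main.v *)
Require Import Defs.
From HB Require Import structures.
From mathcomp Require Import all_boot all_order all_algebra.

Set Implicit Arguments.
Unset Strict Implicit.
Unset Printing Implicit Defensive.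

Import GRing.Theory.
Local Open Scope ring_scope.

(** Write Psi (a ⊗ b) = sum a2 b ⊗ a1 for the map of ℓEAS(A, m, Delta^op), and
    Phi (a ⊗ b) = sum b1 ⊗ S(b2) a.  The proof works with Psi rather than Phi,
    because the antipode does not occur in it.

    - Psi and Phi are mutually inverse ([lEAS_of_coopK], [hopf_mapK]): up to
      coassociativity,
        Phi (Psi (a ⊗ b)) = sum a1 ⊗ S(a2) a3 b = sum a1 ⊗ eps(a2) b = a ⊗ b,
        Psi (Phi (a ⊗ b)) = sum b2 S(b3) a ⊗ b1 = sum eps(b2) a ⊗ b1 = a ⊗ b.
    - Psi satisfies the ℓEAS equation for any bialgebra ([lEAS_of_coop]): since
      Delta is multiplicative and coassociative, both sides send a ⊗ b ⊗ c to
        sum a3 b2 c ⊗ a2 b1 ⊗ a1.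
    - The ℓEAS equation Psi23 Psi12 Psi23 = Psi12 tau23 Psi12 reads the same
      from right to left and tau is an involution, so that inverting both sides
      gives the same equation for the inverse of Psi ([lEAS_inverse]).

    Sweedler's notation is rendered by choosing a decomposition of Delta a into
    a finite sum of pure tensors ([tens_sum]).  An iterated coproduct is not
    decomposed further: its terms are the values, at assoc (Delta a1 ⊗ a2) or at
    a1 ⊗ Delta a2, of a linear map G on A ⊗ (A ⊗ A), and coassociativity is
    the passage from one form to the other ([coassoc_sum]). *)

Lemma tens_sum (K : fieldType) (U V : lmodType K) (x : U ⊗ V) :
  exists r : seq (U * V), x = \sum_(p <- r) p.1 ⊗t p.2.
Proof.
elim/tens_ind: x => [|_ _ [r ->] [s ->]|u v].
- by exists [::]; rewrite big_nil.
- by exists (r ++ s); rewrite big_cat.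
- by exists [:: (u, v)]; rewrite big_seq1.
Qed.

Lemma tens3_linear_ext (K : fieldType) (U V W X : lmodType K)
    (f g : {linear U ⊗ V ⊗ W -> X}) :
  (forall u v w, f (u ⊗t v ⊗t w) = g (u ⊗t v ⊗t w)) -> f =1 g.
Proof.
move=> fg; apply: tens_linear_ext => t w; have [r ->] := tens_sum t.
by rewrite linear_sumlz !linear_sum; apply: eq_bigr => p _; exact: fg.
Qed.

(** Right multiplication, bundled as a linear map so that it can be an argument
    of [tmap]. *)
Definition mulr_by {K : fieldType} {A : algType K} (b : A) : {linear A -> A} :=
  mulmap A \o applyr (@tensor K A A) b.

Lemma mulr_byE (K : fieldType) (A : algType K) (b x : A) :
  mulr_by b x = x * b.
Proof. exact: mulmapE. Qed.

Section Inverse.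
Variables (K : fieldType).
Implicit Types U V W : lmodType K.

Lemma assocK U V W : cancel (assoc U V W) (assocV U V W).
Proof.
elim/tens_ind=> [|x y IHx IHy|t w]; rewrite ?linear0 // ?linearD ?IHx ?IHy //.
elim/tens_ind: t => [|x y IHx IHy|u v]; last by rewrite assocE assocVE.
  by rewrite linear0l !linear0.
by rewrite linearDl !linearD IHx IHy.
Qed.

Lemma assocVK U V W : cancel (assocV U V W) (assoc U V W).
Proof.
elim/tens_ind=> [|x y IHx IHy|u t]; rewrite ?linear0 // ?linearD ?IHx ?IHy //.
elim/tens_ind: t => [|x y IHx IHy|v w]; last by rewrite assocVE assocE.
  by rewrite linear0r !linear0.
by rewrite linearDr !linearD IHx IHy.
Qed.

Lemma tmapK U U' V V' (f : {linear U -> U'}) (f' : {linear U' -> U})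
    (g : {linear V -> V'}) (g' : {linear V' -> V}) :
  cancel f f' -> cancel g g' -> cancel (tmap f g) (tmap f' g').
Proof.
move=> fK gK; elim/tens_ind=> [|x y IHx IHy|u v].
- by rewrite !linear0.
- by rewrite !linearD IHx IHy.
- by rewrite !tmapE fK gK.
Qed.

Variables (V : lmodType K) (f g : {linear V ⊗ V -> V ⊗ V}).
Hypothesis fK : cancel f g.

Lemma actlK W : cancel (actl W f) (actl W g).
Proof. exact: tmapK. Qed.

Lemma actrK W : cancel (actr W f) (actr W g).
Proof.
have tK : cancel (tmap (idfun : {linear W -> W}) f) (tmap idfun g).
  exact: tmapK.
exact: (can_comp (can_comp (@assocVK W V V) tK) (@assocK W V V)).
Qed.

End Inverse.

Lemma tauK (K : fieldType) (U V : lmodType K) : cancel (tau U V) (tau V U).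
Proof.
elim/tens_ind=> [|x y IHx IHy|u v]; first by rewrite !linear0.
- by rewrite !linearD IHx IHy.
- by rewrite !tauE.
Qed.

(** The equation f23 f12 f23 = f12 t23 f12 is a palindrome on both sides, hence
    it is carried to itself by inversion, which reverses words. *)
Lemma palindrome_inverse (T : Type) (f12 f23 g12 g23 t23 : T -> T) :
  cancel g12 f12 -> cancel f12 g12 -> cancel f23 g23 -> involutive t23 ->
  f23 \o f12 \o f23 =1 f12 \o t23 \o f12 ->
  g23 \o g12 \o g23 =1 g12 \o t23 \o g12.
Proof.
move=> g12K f12K f23K t23K fE x /=.
(* this point is chosen because the right-hand side of fE sends it to x *)
have /= := fE (g12 (t23 (g12 x))).
rewrite g12K t23K g12K => {1}<-.
by rewrite f23K f12K f23K.
Qed.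

Lemma lEAS_inverse (K : fieldType) (V : lmodType K)
    (f g : {linear V ⊗ V -> V ⊗ V}) :
  cancel f g -> cancel g f ->
  is_lEAS (TensorEndo f) -> is_lEAS (TensorEndo g).
Proof.
move=> fK gK.
exact: (palindrome_inverse (actlK gK (W := V)) (actlK fK (W := V))
          (actrK fK (W := V)) (actrK (@tauK K V V) (W := V))).
Qed.

Section Coalgebra.
Variables (K : fieldType) (A : algType K).
Variables (Delta : {linear A -> A ⊗ A}) (eps : {linear A -> K^o}).
Hypothesis coalgA : is_coalgebra Delta eps.

(** Coassociativity in Sweedler form: for every trilinear expression G,
    sum G(a11, a12, a2) = sum G(a1, a21, a22), where only one level of
    coproduct is split into pure tensors. *)
Lemma coassoc_sum (W : lmodType K) (G : {linear A ⊗ (A ⊗ A) -> W}) a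
    (r : seq (A * A)) :
  Delta a = \sum_(p <- r) p.1 ⊗t p.2 ->
  \sum_(p <- r) G (assoc A A A (Delta p.1 ⊗t p.2))
  = \sum_(p <- r) G (p.1 ⊗t Delta p.2).
Proof.
move=> aE; have /= := coassociative coalgA a; rewrite aE !linear_sum.
move/(congr1 G); rewrite !linear_sum => GE.
transitivity (\sum_(p <- r) G (assoc A A A (tmap Delta idfun (p.1 ⊗t p.2)))).
  by apply: eq_bigr => p _; rewrite tmapE.
by rewrite GE; apply: eq_bigr => p _; rewrite tmapE.
Qed.

Lemma counit_r_sum a (r : seq (A * A)) :
  Delta a = \sum_(p <- r) p.1 ⊗t p.2 ->
  \sum_(p <- r) (eps p.2 : K) *: p.1 = a.
Proof.
move=> aE; have /= := counit_r coalgA a; rewrite aE !linear_sum => <-.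
by apply: eq_bigr => p _; rewrite tmapE /= tauE lunitE.
Qed.

End Coalgebra.

Section Bialgebra.
Variables (K : fieldType) (A : algType K).
Variables (Delta : {linear A -> A ⊗ A}) (eps : {linear A -> K^o}).
Hypothesis bialgA : is_bialgebra Delta eps.

Let coalgA := bialgebra_coalgebra bialgA.
Let Psi : {linear A ⊗ A -> A ⊗ A} := te_map (lEAS_of (coop Delta)).

(** Only Delta b is decomposed: the right-hand side stays linear in Delta a,
    which lets [coassoc_sum] apply to it when a is itself a Sweedler
    component. *)
Lemma comulM_sum a b (s : seq (A * A)) :
  Delta b = \sum_(q <- s) q.1 ⊗t q.2 ->
  Delta (a * b)
  = \sum_(q <- s) tmap (mulr_by q.1) (mulr_by q.2) (Delta a).
Proof.
move=> bE; have := comulM bialgA (a ⊗t b).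
rewrite /comp mulmapE tmapE => ->; have [r ->] := tens_sum (Delta a).
rewrite bE linear_sumr !linear_sum; apply: eq_bigr => q _.
rewrite linear_sumlz !linear_sum; apply: eq_bigr => p _.
by rewrite tau_midE !tmapE !mulmapE !mulr_byE.
Qed.

Lemma lEAS_of_coop_tensor a b :
  Psi (a ⊗t b) = tau A A (tmap idfun (mulr_by b) (Delta a)).
Proof.
have [r aE] := tens_sum (Delta a).
rewrite [LHS](lEAS_of_coopE _ aE) aE !linear_sum; apply: eq_bigr => p _.
by rewrite tmapE tauE mulr_byE.
Qed.

(** Both sides send a ⊗ b ⊗ c to sum a3 b2 c ⊗ a2 b1 ⊗ a1.  The left-hand side
    produces it with a1, a2 obtained by splitting the first component of
    Delta a, the right-hand side with a2, a3 obtained by splitting the second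
    one. *)
Lemma lEAS_of_coop : is_lEAS (lEAS_of (coop Delta)).
Proof.
suff E : actr A Psi \o actl A Psi \o actr A Psi
    =1 actl A Psi \o actr A (tau A A) \o actl A Psi by exact: E.
have Psi12 x y z : actl A Psi (x ⊗t y ⊗t z) = Psi (x ⊗t y) ⊗t z.
  exact: tmapE.
have Psi23 x y z : actr A Psi (x ⊗t y ⊗t z) = assocV A A A (x ⊗t Psi (y ⊗t z)).
  by rewrite [LHS]/= assocE tmapE.
have tau23 x y z : actr A (tau A A) (x ⊗t y ⊗t z) = x ⊗t z ⊗t y.
  by rewrite [LHS]/= assocE tmapE tauE assocVE.
suff pure a b c : actr A Psi (actl A Psi (actr A Psi (a ⊗t b ⊗t c)))
    = actl A Psi (actr A (tau A A) (actl A Psi (a ⊗t b ⊗t c))).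
  by apply: tens3_linear_ext => a b c; exact: pure.
have [r aE] := tens_sum (Delta a); have [s bE] := tens_sum (Delta b).
(* G q (u ⊗ (v ⊗ w)) = (w q2 c) ⊗ (v q1) ⊗ u, for q a term q1 ⊗ q2 of Delta b *)
pose H q : {linear A ⊗ A -> A ⊗ A} :=
  tau A A \o tmap (mulr_by q.1) (mulr_by c \o mulr_by q.2).
pose G q : {linear A ⊗ (A ⊗ A) -> A ⊗ A ⊗ A} :=
  tau A (A ⊗ A) \o tmap idfun (H q).
have GE q x (t : A ⊗ A) : G q (x ⊗t t) = H q t ⊗t x.
  by rewrite [LHS]/= tmapE tauE.
have HE q v w : H q (v ⊗t w) = (w * q.2 * c) ⊗t (v * q.1).
  rewrite [LHS]/= tmapE tauE /= !mulmapE; reflexivity.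
transitivity (\sum_(q <- s) \sum_(p <- r) G q (assoc A A A (Delta p.1 ⊗t p.2))).
  rewrite Psi23 [Psi _](lEAS_of_coopE _ bE) linear_sumr !linear_sum.
  apply: eq_bigr => q _; rewrite assocVE Psi12 [Psi _](lEAS_of_coopE _ aE).
  rewrite linear_sumlz linear_sum; apply: eq_bigr => p _; rewrite Psi23.
  have [r' xE] := tens_sum (Delta p.1).
  rewrite [Psi _](lEAS_of_coopE _ xE) xE linear_sumr linear_sumlz !linear_sum.
  by apply: eq_bigr => p' _; rewrite assocVE assocE GE HE mulrA.
under eq_bigr do rewrite (coassoc_sum coalgA _ aE).
rewrite exchange_big Psi12 [Psi _](lEAS_of_coopE _ aE).
rewrite linear_sumlz !linear_sum; apply: eq_bigr => p _.
rewrite tau23 Psi12 lEAS_of_coop_tensor (comulM_sum p.2 bE) !linear_sum.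
rewrite linear_sumlz.
apply: eq_bigr => q _; rewrite GE; congr (_ ⊗t _).
have [r' ->] := tens_sum (Delta p.2).
rewrite !linear_sum; apply: eq_bigr => p' _.
by rewrite HE !tmapE tauE !mulr_byE.
Qed.

End Bialgebra.

Section HopfMap.
Variables (K : fieldType) (A : algType K).
Variables (Delta : {linear A -> A ⊗ A}) (eps : {linear A -> K^o}).
Variable S : {linear A -> A}.
Hypothesis hopfA : is_hopf Delta eps S.

Let coalgA := bialgebra_coalgebra (hopf_bialgebra hopfA).
Let Phi := hopf_map Delta S.
Let Psi : {linear A ⊗ A -> A ⊗ A} := te_map (lEAS_of (coop Delta)).

(** The left antipode axiom makes sum a1 ⊗ S(a2) a3 b collapse to
    sum a1 ⊗ eps(a2) b. *)
Lemma lEAS_of_coopK : cancel Psi Phi.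
Proof.
suff pure a b : Phi (Psi (a ⊗t b)) = a ⊗t b.
  have E : Phi \o Psi =1 idfun by apply: tens_linear_ext; exact: pure.
  exact: E.
have [r aE] := tens_sum (Delta a).
(* G (u ⊗ (v ⊗ w)) = u ⊗ S(v) w b *)
pose G : {linear A ⊗ (A ⊗ A) -> A ⊗ A} :=
  tmap idfun (mulr_by b \o mulmap A \o tmap S idfun).
have PhiG x y : Phi ((y * b) ⊗t x) = G (assoc A A A (Delta x ⊗t y)).
  have [s xE] := tens_sum (Delta x).
  rewrite [Phi _](hopf_mapE _ _ xE) xE linear_sumlz !linear_sum.
  apply: eq_bigr => q _; rewrite assocE tmapE [X in _ = _ ⊗t X]/=.
  by rewrite tmapE mulmapE mulrA mulmapE.
have GE x y : G (x ⊗t Delta y) = ((eps y : K) *: x) ⊗t b.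
  have /= Sy := antipode_l hopfA y.
  rewrite /G tmapE /= Sy mulmapE -scalerAl mul1r.
  by rewrite linearZl_LR linearZr_LR.
rewrite [Psi _](lEAS_of_coopE _ aE) linear_sum.
under eq_bigr do rewrite PhiG.
rewrite (coassoc_sum coalgA _ aE).
under eq_bigr do rewrite GE.
by rewrite -linear_sumlz (counit_r_sum coalgA aE).
Qed.

(** The right antipode axiom makes sum b2 S(b3) a ⊗ b1 collapse
    to sum eps(b2) a ⊗ b1. *)
Lemma hopf_mapK : cancel Phi Psi.
Proof.
suff pure a b : Psi (Phi (a ⊗t b)) = a ⊗t b.
  have E : Psi \o Phi =1 idfun by apply: tens_linear_ext; exact: pure.
  exact: E.
have [r bE] := tens_sum (Delta b).
(* G (u ⊗ (v ⊗ w)) = v S(w) a ⊗ u *)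
pose G : {linear A ⊗ (A ⊗ A) -> A ⊗ A} :=
  tau A A \o tmap idfun (mulr_by a \o mulmap A \o tmap idfun S).
have PsiG x y : Psi (x ⊗t (S y * a)) = G (assoc A A A (Delta x ⊗t y)).
  have [s xE] := tens_sum (Delta x).
  rewrite [Psi _](lEAS_of_coopE _ xE) xE linear_sumlz !linear_sum.
  apply: eq_bigr => q _; rewrite assocE /= tmapE tauE /=.
  by rewrite tmapE mulmapE mulrA mulmapE.
have GE x y : G (x ⊗t Delta y) = a ⊗t ((eps y : K) *: x).
  have /= Sy := antipode_r hopfA y.
  rewrite /G /= tmapE tauE /= Sy mulmapE -scalerAl mul1r.
  by rewrite linearZl_LR linearZr_LR.
rewrite [Phi _](hopf_mapE _ _ bE) linear_sum.
under eq_bigr do rewrite PsiG.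
rewrite (coassoc_sum coalgA _ bE).
under eq_bigr do rewrite GE.
by rewrite -linear_sumr (counit_r_sum coalgA bE).
Qed.

End HopfMap.

Theorem proposition5p10 (K : fieldType) (A : algType K)
    (Delta : {linear A -> A ⊗ A}) (eps : {linear A -> K^o})
    (S : {linear A -> A}) (hopfA : is_hopf Delta eps S) :
  let Phi := hopf_map Delta S in
  [/\ is_lEAS (TensorEndo Phi),
      lEAS_nondegenerate (TensorEndo Phi)
    & exists2 Phi_inv : {linear A ⊗ A -> A ⊗ A},
        cancel Phi Phi_inv /\ cancel Phi_inv Phi
      & TensorEndo Phi_inv = lEAS_of (coop Delta)].
Proof.
move=> Phi; have PhiK := hopf_mapK hopfA; have PsiK := lEAS_of_coopK hopfA.
split.
- by apply: lEAS_inverse PsiK PhiK _; exact: lEAS_of_coop (hopf_bialgebra hopfA).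
- by exists (lEAS_of (coop Delta)).
- by exists (te_map (lEAS_of (coop Delta))).
Qed.
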